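(* For every integer $n>1$, $l(n)\leq 0.75\,n^2$. Equivalently in spirit: every generalized Latin square of order $n>1$ containing at least $l(n)$ symbols, where $l(n)\le 0.75n^2$, has a transversal.
   Context: A generalized Latin square of order $n$ is an $n\times n$ matrix whose entries are symbols, such that each symbol appears at most once in each row and at most once in each column. A diagonal is a set of $n$ entries containing exactly one entry from each row and exactly one from each column; a transversal is a diagonal whose $n$ entries are pairwise distinct symbols. $l(n)$ denotes the least integer such that every generalized Latin square of order $n$ containing at least $l(n)$ distinct symbols has a transversal. (Equivalently, $l(n)$ is the least number of colors such that every proper edge-coloring of $K_{n,n}$ with at least $l(n)$ colors has a perfect matching whose edges have pairwise distinct colors.) *)

(* Defs.v *)
From mathcomp Require Import all_boot all_order all_algebra.
From mathcomp Require Import boolp.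
Set Implicit Arguments.
Unset Strict Implicit.
Unset Printing Implicit Defensive.

Definition generalized_latin_square (n : nat) (T : eqType) (L : 'M[T]_n) : Prop :=
  (forall i : 'I_n, injective (fun j : 'I_n => L i j)) /\
  (forall j : 'I_n, injective (fun i : 'I_n => L i j)).

Definition num_symbols (n : nat) (T : eqType) (L : 'M[T]_n) : nat :=
  size (undup [seq L p.1 p.2 | p <- enum {: 'I_n * 'I_n}]).

(* Entries are identified with their positions, since distinct entries of the
   matrix may carry the same symbol. *)
Definition diagonal (n : nat) (D : {set 'I_n * 'I_n}) : Prop :=
  [/\ #|D| = n,
      forall i : 'I_n, #|[set p in D | p.1 == i]| = 1 &
      forall j : 'I_n, #|[set p in D | p.2 == j]| = 1].

Definition transversal (n : nat) (T : eqType) (L : 'M[T]_n)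
    (D : {set 'I_n * 'I_n}) : Prop :=
  diagonal D /\ {in D &, injective (fun p => L p.1 p.2)}.

Definition forces_transversal (n m : nat) : Prop :=
  forall (T : eqType) (L : 'M[T]_n),
    generalized_latin_square L -> m <= num_symbols L ->
    exists D : {set 'I_n * 'I_n}, transversal L D.

Lemma forces_transversal_ex (n : nat) : exists m, `[< forces_transversal n m >].
Proof.
exists (n * n).+1; apply/asboolP => T L _ Hm.
have := leq_trans Hm (size_undup _).
by rewrite size_map -cardE card_prod card_ord ltnn.
Qed.

(* The least element is taken in nat, so it is 0 for an order n at which every
   generalized Latin square has a transversal (for instance n = 1). *)
Definition l (n : nat) : nat := ex_minn (forces_transversal_ex n).

(* Main.v *)
Require Import Defs.
From mathcomp Require Import all_boot all_order all_algebra.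
From mathcomp Require Import all_fingroup zify.
From mathcomp Require boolp.
Import Order.TTheory GRing.Theory Num.Theory.

(** Among all diagonals take one with the most distinct symbols and, among
    those, the most entries whose symbol occurs only once in the matrix
    ("single" entries); permuting columns, it is the main diagonal.  Suppose it
    repeats a symbol, [L u u = L k k].  Let [s] be the number of single diagonal
    entries, [t] the number of the others, [O] the set of symbols of the latter
    (at most [t - 1]).  Weigh single entries 2, entries with a symbol in [O] 0
    and all others 1: twice the number of symbols is at most the total weight
    plus [2 #|O|].  By extremality no exchange along a short cycle improves the
    diagonal.  Exchanging two rows bounds the weight of opposite pairs [(i,j)],
    [(j,i)] by 2, 3 or 4 according to whether none, one or both of [i], [j] are
    single, and by 2 whenever one of them is [u] or [k]; for [3 n^2 / 4] symbols
    this forces [s >= t + 2].  Then row and column [u] have so many symbols off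
    the diagonal that at least [s - t + 3] indices [i] satisfy
    [L u i = L i u] with a new symbol.  Rotating along [u -> i -> j -> u] for two
    of them moves the repeated symbol to further diagonal positions [m], for
    which the weights also drop from 3 to 2 up to six exceptions, and this makes
    the total weight too small. *)

(** * Numerical inequalities *)

Lemma many_singles_arith {n s t X q o : nat} : n = s + t -> o < t -> 1 < t ->
    4 * q <= 4 * (s * s) + 2 * X + 2 * (t * t.-1) + 4 * o ->
    X + 2 * s <= 3 * (s * t) -> 3 * (n * n) < 4 * q + 4 ->
  t + 2 <= s.
Proof.
move=> ->; case: t => // t ot t1 hq hX hlt.
(* With [t] now one less than in the statement, this gives [t^2 < (s - 2)^2]. *)
have h : t * t + 4 * s <= s * s by move: hq hX hlt; rewrite /= !(mulnDl, mulnDr, mulSn, mulnS) [t * s]mulnC; lia.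
case: s {hq hX hlt} h => [|[|s]] h; [by nia|by nia|].
rewrite leqNgt; apply/negP => st.
have := @leq_mul s s t t; lia.
Qed.
Lemma few_colors_arith {n s t c K X q o : nat} : n = s + t -> o < t -> t + 2 <= s ->
    2 * s + 3 <= c + n -> c <= t -> c <= K + 2 ->
    4 * q <= 4 * (s * s) + 2 * X + 2 * (t * t.-1) + 4 * o ->
    X + 2 * s + K * s <= 3 * (s * t) + 6 * K ->
  4 * q + 4 <= 3 * (n * n).
Proof.
move=> -> ot ts hc ct cK hq hX; rewrite leqNgt; apply/negP => hlt.
have [g sE] : exists g, s = t + g.+2 by exists (s - t - 2); lia.
have [f tE] : exists f, t = g + 5 + f by exists (t - g - 5); lia.
have [e KE] : exists e, K = g + 3 + e by exists (K - g - 3); lia.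
have {c hc ct cK} h : (t.-1 * t.-1) + 4 * s + 2 * K * s <= s * s + 12 * K.
  move: hq hX hlt; case: t ot {ts sE tE hc ct} => // t ot.
  rewrite /= !(mulnDl, mulnDr, mulSn, mulnS) ?[t * s]mulnC; lia.
move: h; have -> : t.-1 = g + 4 + f by lia.
(* After substituting the slacks, the left side of [h] exceeds the right side by
   [g^2 + 2g + 4f + 4eg + 2ef + 2e + 1]. *)
have := (leq0n (g * g), leq0n (e * g), leq0n (e * f)).
rewrite KE sE tE => -[[? ?] ?]; lia.
Qed.

(** * Exchanges on an extremal main diagonal *)

Section MaximalDiagonal.
Local Set Implicit Arguments.
Local Unset Strict Implicit.

Variables (n : nat) (C : finType) (L : 'I_n -> 'I_n -> C).
Hypothesis rowI : forall i, injective (L i).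
Hypothesis colI : forall j, injective (L^~ j).
Implicit Types (i j t l m x y : 'I_n) (p : {perm 'I_n}).

Definition single i j :=
  [forall x, forall y, (L x y == L i j) ==> (x == i) && (y == j)].
Definition colors p := [set L i (p i) | i : 'I_n].
Definition singles p := [set i | single i (p i)].

Local Notation D := [set L i i | i : 'I_n].
Local Notation S := [set i | single i i].
Local Notation new i j := (L i j \notin D).

Lemma singleP i j x y : single i j -> L x y = L i j -> x = i /\ y = j.
Proof.
by move=> /forallP/(_ x)/forallP/(_ y) h e; move: h; rewrite e eqxx => /andP[/eqP-> /eqP->].
Qed.

Lemma single_new i j : i != j -> single i j -> new i j.
Proof.
move=> ij s; apply/negP => /imsetP[x _ e].
by have [xi xj] := singleP s (esym e); rewrite -xi -xj eqxx in ij.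
Qed.

(** [D] and [gain] are disjoint, and their union lies in the union of [colors p] and [lost]. So
    [lost] only has to list the diagonal symbols that may vanish. *)
Lemma exchange p (lost gain : seq C) :
    (forall x, p x != x -> L x x \in lost \/ exists y, L y (p y) = L x x) ->
    uniq gain ->
    (forall c, c \in gain -> c \notin D /\ exists y, L y (p y) = c) ->
  #|D| + size gain <= #|colors p| + size lost.
Proof.
move=> hl ug hg.
have dis : D :&: [set:: gain] = set0.
  apply/setP => c; rewrite !inE; apply/andP => -[cD cg].
  by case: (hg c cg); rewrite cD.
have sub : D :|: [set:: gain] \subset colors p :|: [set:: lost].
  apply/subsetP => c; rewrite !inE => /orP[/imsetP[x _ ->]|/hg[_ [y <-]]].
    have [px|/hl[->|[y <-]]] := eqVneq (p x) x; last 2 first.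
    - by rewrite orbT.
    - by rewrite imset_f.
    by apply/orP; left; apply/imsetP; exists x; rewrite ?px.
  by rewrite imset_f.
have := subset_leq_card sub; rewrite cardsU dis cards0 subn0.
have -> : #|[set:: gain]| = size gain by rewrite cardsE; apply/card_uniqP.
move=> /leq_trans; apply; rewrite cardsU; apply: leq_trans (leq_subr _ _) _.
by rewrite leq_add2l cardsE card_size.
Qed.

Hypothesis max_colors : forall p, #|colors p| <= #|D|.
Lemma exchange_absurd p (lost gain : seq C) : size lost < size gain ->
    (forall x, p x != x -> L x x \in lost \/ exists y, L y (p y) = L x x) ->
    uniq gain ->
    (forall c, c \in gain -> c \notin D /\ exists y, L y (p y) = c) ->
  False.
Proof.
move=> lt hl ug hg; have := exchange hl ug hg; have := max_colors p; lia.
Qed.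

Hypothesis max_singles : forall p, #|colors p| = #|D| -> #|singles p| <= #|S|.

(** Two new symbols make up for the two that may be lost, so the number of colors stays maximal and
    the second criterion applies. *)
Lemma swap_singles t l : t != l -> new t l -> new l t -> L t l != L l t ->
  #|singles (tperm t l)| <= #|S|.
Proof.
move=> tl n1 n2 d; apply: max_singles; apply/eqP; rewrite eqn_leq max_colors /=.
have := @exchange (tperm t l) [:: L t t; L l l] [:: L t l; L l t].
rewrite leq_add2r; apply.
- move=> x; case: tpermP => [->|->|]; rewrite ?inE ?eqxx ?orbT; auto.
- by rewrite /= inE d.
- by move=> c; rewrite !inE => /orP[]/eqP->; split=> //; [exists t|exists l]; rewrite ?tpermL ?tpermR.
Qed.

(** Row [t] gains a single entry. The only single entry at risk is the one in row [j], and the last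
    hypothesis covers it. *)
Lemma swap_more_singles t j : t \notin S -> t != j -> single t j ->
  single j t || (j \notin S) -> #|S| < #|singles (tperm t j)|.
Proof.
move=> tS tj s1 h.
rewrite -[X in X < _]addn0 -addnS -[1%N](cards1 t) -cardsUI.
have -> : #|S :&: [set t]| = 0%N.
  by apply/eqP; rewrite cards_eq0 setI_eq0 disjoint_sym disjoints1.
rewrite addn0; apply/subset_leq_card/subsetP => x.
rewrite !inE => /orP[sx|/eqP->]; last by rewrite tpermL.
case: tpermP => [->//|e|//]; rewrite {}e in sx *.
have jS : j \in S by rewrite inE.
by move: h; rewrite jS orbF.
Qed.

Lemma T_no_two_singles t j : t \notin S -> t != j -> single t j -> ~~ single j t.
Proof.
move=> tS tj s1; apply/negP => s2; have jt : j != t by rewrite eq_sym.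
have d : L t j != L j t.
  by apply/eqP => /(singleP s2)[e]; rewrite e eqxx in tj.
have := swap_singles tj (single_new tj s1) (single_new jt s2) d.
by rewrite leqNgt swap_more_singles ?s2.
Qed.

Lemma T_single_old t j : t \notin S -> j \notin S -> t != j -> single t j -> ~~ new j t.
Proof.
move=> tS jS tj s1; apply/negP => n2.
have d : L t j != L j t.
  by apply/eqP => /esym/(singleP s1)[e]; rewrite e eqxx in tj.
have := swap_singles tj (single_new tj s1) n2 d.
by rewrite leqNgt swap_more_singles ?jS ?orbT.
Qed.

(** Swapping [u] and [l] loses at most the symbol of [(l, l)], because that of [(u, u)] also stands
    at [(k, k)]. Two distinct new symbols would be a net gain. *)
Lemma dup_pair u k l : u != k -> L u u = L k k -> u != l ->
  new u l -> new l u -> L u l = L l u.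
Proof.
move=> uk e ul n1 n2; apply/eqP/negPn/negP => d.
apply: (@exchange_absurd (tperm u l) [:: L l l] [:: L u l; L l u]) => //.
- move=> x; case: tpermP => [->|->|]; rewrite ?inE ?eqxx ?orbT; auto.
  have [<-|kl] := eqVneq k l; first by rewrite e eqxx; left.
  by right; exists k; rewrite tpermD ?e // eq_sym.
- by rewrite /= inE d.
- by move=> c; rewrite !inE => /orP[]/eqP->; split=> //; [exists u|exists l]; rewrite ?tpermL ?tpermR.
Qed.

(** * Old symbols and weights of opposite pairs *)

Local Notation O := [set L t t | t in ~: S].

Lemma old_nonsingle i j : i != j -> ~~ new i j -> L i j \in O.
Proof.
move=> ij /negPn/imsetP[x _ e]; apply/imsetP; exists x => //; rewrite !inE.
by apply/negP => sx; have [ix jx] := singleP sx e; rewrite ix jx eqxx in ij.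
Qed.

Lemma O_old c : c \in O -> c \in D.
Proof. by move=> /imsetP[x _ ->]; rewrite imset_f. Qed.

(* Every symbol that occurs in the matrix and is not in [O] has total weight at
   least 2. *)
Definition W i j := if single i j then 2 else if L i j \in O then 0 else 1.
Definition W2 i j := W i j + W j i.

Lemma colors_le_weight :
  2 * #|[set L c.1 c.2 | c : 'I_n * 'I_n]| <= \sum_i \sum_j W i j + 2 * #|O|.
Proof.
rewrite pair_big /= (partition_big (fun c => L c.1 c.2) xpredT) //=.
rewrite -!sum1_card !big_distrr /= !(big_mkcond (fun c => c \in _)) /= -big_split /=.
apply: leq_sum => c _; case: ifP => // /imsetP[[x y] _ /= ->].
case: ifP => hO; first by rewrite leq_addl.
rewrite addn0 (bigD1 (x, y)) //= {1}/W hO.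
case: ifPn => [sxy|nsxy]; first by rewrite leq_addr.
(* A second position with the same symbol supplies the missing unit of weight. *)
have [[x' y'] /andP[/= /eqP e ne]] : exists c, (L c.1 c.2 == L x y) && (c != (x, y)).
  move: nsxy; rewrite negb_forall => /existsP[x' ]; rewrite negb_forall => /existsP[y'].
  by rewrite negb_imply => /andP[e ne]; exists (x', y'); rewrite e.
rewrite (bigD1 (x', y')) /= ?e ?eqxx // addnA; apply: leq_trans (leq_addr _ _).
by rewrite ltnS /W e hO; case: ifP.
Qed.

Lemma W2C i j : W2 i j = W2 j i.
Proof. exact: addnC. Qed.

Lemma W_le2 i j : W i j <= 2.
Proof. by rewrite /W; do 2?case: ifP. Qed.

Lemma W_nonsingle i j : ~~ single i j -> W i j <= 1.
Proof. by rewrite /W => /negPf->; case: ifP. Qed.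

Lemma W_O i j : ~~ single i j -> L i j \in O -> W i j = 0.
Proof. by rewrite /W => /negPf-> ->. Qed.

Lemma W2_le4 i j : W2 i j <= 4.
Proof. exact: leq_add (W_le2 _ _) (W_le2 _ _). Qed.

Lemma W2_T t l : t \notin S -> t != l -> W2 t l <= 3.
Proof.
move=> tS tl; rewrite /W2; case: (boolP (single t l)) => [s1|ns].
  by rewrite (leq_add (W_le2 _ _)) // W_nonsingle // T_no_two_singles.
by rewrite addnC (leq_add (W_le2 _ _)) // W_nonsingle.
Qed.

(** Weight 3 needs a single entry. Were the opposite entry old, it would weigh 0 and the pair at
    most 2. *)
Lemma W2_gt2 t l : t \notin S -> t != l -> 2 < W2 t l ->
  [/\ new t l, new l t & L t l != L l t].
Proof.
move=> tS tl; have lt : l != t by rewrite eq_sym.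
have aux x y : x != y -> single x y -> ~~ single y x -> 2 < W2 x y ->
    [/\ new x y, new y x & L x y != L y x].
  move=> xy s1 s2 h; split; first exact: single_new.
    apply: contraL h => h; have hO : L y x \in O by apply: old_nonsingle; rewrite ?negbK // eq_sym.
    by rewrite /W2 (W_O s2 hO) addn0 -leqNgt W_le2.
  by apply/eqP => /esym/(singleP s1)[e]; rewrite e eqxx in xy.
case: (boolP (single t l)) => s1; first exact: aux (T_no_two_singles tS tl s1).
case: (boolP (single l t)) => s2.
  by rewrite W2C => /(aux _ _ lt s2 s1)[? ?]; rewrite eq_sym.
by rewrite /W2 ltnNge (leq_add (W_nonsingle s1)) ?W_nonsingle.
Qed.

(** A pair of weight above 2 has both entries new, but by [T_single_old] a single entry here makes
    its opposite old. *)
Lemma W2_TT t j : t \notin S -> j \notin S -> t != j -> W2 t j <= 2.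
Proof.
move=> tS jS tj; rewrite leqNgt; apply/negP => big.
have [n1 n2 _] := W2_gt2 tS tj big; have jt : j != t by rewrite eq_sym.
have s1 : ~~ single t j by apply: contraL n2; exact: T_single_old.
have s2 : ~~ single j t by apply: contraL n1; exact: T_single_old.
by move: big; rewrite ltnNge /W2 (leq_add (W_nonsingle s1)) ?W_nonsingle.
Qed.

Lemma W2_Tdiag t : t \notin S -> W2 t t = 0.
Proof.
move=> tS; have st : ~~ single t t by move: tS; rewrite inE.
by rewrite /W2 W_O //; apply/imsetP; exists t; rewrite // inE.
Qed.

Lemma dup_nonsingle u k : u != k -> L u u = L k k -> u \notin S.
Proof.
move=> uk e; rewrite inE; apply/negP => s.
by have [ku _] := singleP s (esym e); rewrite ku eqxx in uk.
Qed.

Lemma W2_dup u k l : u != k -> L u u = L k k -> u != l -> W2 u l <= 2.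
Proof.
move=> uk e ul; rewrite leqNgt; apply/negP => big.
have [n1 n2 /eqP] := W2_gt2 (dup_nonsingle uk e) ul big; apply.
exact: dup_pair e ul n1 n2.
Qed.

(** * Rotations through a repeated symbol *)

Variables u k : 'I_n.
Hypothesis uk : u != k.
Hypothesis euk : L u u = L k k.

Let uS : u \notin S := dup_nonsingle uk euk.
Let kS : k \notin S.
Proof. by apply: (@dup_nonsingle k u); rewrite // eq_sym. Qed.

Lemma card_O : #|O| < #|~: S|.
Proof.
rewrite [X in _ < X](cardsD1 u) inE uS add1n ltnS.
apply: leq_trans (leq_imset_card (fun t => L t t) _).
apply/subset_leq_card/subsetP => _ /imsetP[t tS ->].
have [->|tu] := eqVneq t u; last by apply: imset_f; rewrite in_setD1 tu.
by rewrite euk; apply: imset_f; rewrite in_setD1 eq_sym uk in_setC kS.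
Qed.

Local Notation twin := [set i | new u i && new i u].

Lemma diag_old i : ~~ new i i.
Proof. by rewrite negbK imset_f. Qed.

(** Row [u] and column [u] each have at most [#|O|] old entries, hence at least [#|S| + 1] new ones.
    The two index sets both miss [u], so they overlap in at least [2 * (#|S| + 1) - (n - 1)]
    indices. *)
Lemma card_twin : 2 * #|S| + 3 <= #|twin| + n.
Proof.
have uO : L u u \in O by apply/imsetP; exists u; rewrite // in_setC.
have hr : #|~: [set i | new u i]| <= #|O|.
  rewrite -(card_imset _ (@rowI u)); apply/subset_leq_card/subsetP => _ /imsetP[j jn ->].
  move: jn; rewrite in_setC in_set => jn; have [<-//|uj] := eqVneq u j; exact: old_nonsingle.
have hc : #|~: [set i | new i u]| <= #|O|.
  rewrite -(card_imset _ (@colI u)); apply/subset_leq_card/subsetP => _ /imsetP[j jn ->].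
  move: jn; rewrite in_setC in_set => jn; have [<-//|uj] := eqVneq u j.
  by apply: old_nonsingle; rewrite // eq_sym.
have hu : #|[set i | new u i] :|: [set i | new i u]| < n.
  rewrite -[X in _ < X]card_ord -cardsT; apply: proper_card; apply/properP.
  split; first exact: subsetT.
  by exists u; rewrite ?in_setT // in_setU !in_set negb_or !diag_old.
have ei : [set i | new u i] :&: [set i | new i u] = twin by apply/setP => i; rewrite !inE.
have := cardsUI [set i | new u i] [set i | new i u]; rewrite ei.
have := cardsC [set i | new u i]; have := cardsC [set i | new i u].
have := cardsC S; rewrite card_ord; have := card_O; lia.
Qed.

Lemma twinE i : i \in twin -> [/\ u != i, new u i & L i u = L u i].
Proof.
rewrite inE => /andP[n1 n2].
have ui : u != i by apply: contraNneq (diag_old u) => e; rewrite {2}e.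
by split=> //; rewrite (dup_pair uk euk).
Qed.

(* [u -> i -> j -> u] *)
Definition cyc i j : {perm 'I_n} := (tperm i j * tperm u i)%g.

Lemma cycE i j : u != i -> u != j -> i != j ->
  [/\ cyc i j u = i, cyc i j i = j, cyc i j j = u
    & forall x, x != u -> x != i -> x != j -> cyc i j x = x].
Proof.
move=> ui uj ij; split; rewrite ?permM.
- by rewrite (@tpermD _ i j) ?tpermL // 1?eq_sym.
- by rewrite tpermL tpermD.
- by rewrite tpermR tpermR.
- by move=> x xu xi xj; rewrite permM !tpermD // 1?eq_sym.
Qed.

(** If [L i j] were new, the rotation would gain [L u i], [L i j] and [L j u = L u j], and lose at
    most the symbols of [(i, i)] and [(j, j)]. *)
Lemma twin_old i j : i \in twin -> j \in twin -> i != j -> L i j \in O.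
Proof.
move=> /twinE[ui ni ei] /twinE[uj nj ej] ij; apply: old_nonsingle => //.
apply/negP => nij; have [pu pi pj pD] := cycE ui uj ij.
apply: (@exchange_absurd (cyc i j) [:: L i i; L j j] [:: L u i; L u j; L i j]) => //.
- move=> x; have [->|xi] := eqVneq x i; first by rewrite inE eqxx; left.
  have [->|xj] := eqVneq x j; first by rewrite !inE eqxx orbT; left.
  have [->|xu] := eqVneq x u; last by rewrite pD ?eqxx.
  move=> _; rewrite euk !inE.
  have [->|ki] := eqVneq k i; first by rewrite eqxx; left.
  have [->|kj] := eqVneq k j; first by rewrite eqxx orbT; left.
  by right; exists k; rewrite pD // eq_sym.
- rewrite /= !inE negb_or (inj_eq (@rowI u)) ij -ei (inj_eq (@rowI i)) uj.
  by rewrite (inj_eq (@colI j)) ui.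
- move=> c; rewrite !inE => /or3P[]/eqP->; split=> //; [exists u|exists j|exists i].
  + by rewrite pu.
  + by rewrite pj.
  + by rewrite pi.
Qed.

Lemma card_twin_le : #|twin| <= #|~: S|.
Proof.
have [->|[i iC]] := set_0Vmem twin; first by rewrite cards0.
rewrite (cardsD1 i) iC add1n; apply: leq_trans card_O; rewrite ltnS.
rewrite -(card_imset _ (@rowI i)); apply/subset_leq_card/subsetP => _ /imsetP[j jC ->].
by move: jC; rewrite in_setD1 => /andP[ji jC]; apply: twin_old; rewrite // eq_sym.
Qed.

(* After the rotation [cyc i j] the repeated symbol is the one of [(m, m)], so
   [m] plays the role of [u]. *)
Definition movable i :=
  [set m in ~: S | (L m m != L u u) && [exists j in twin :\ i, L m m == L i j]].

(** Row [i] has [#|twin| - 1] distinct symbols of [O] at the other twins. At most one of them is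
    [L u u]; the rest are diagonal symbols of movable indices. *)
Lemma card_movable i : i \in twin -> #|twin| <= #|movable i| + 2.
Proof.
move=> iC; rewrite (cardsD1 i) iC add1n addnS ltnS.
rewrite -(card_imset _ (@rowI i)).
have h : L i @: (twin :\ i) \subset L u u |: [set L m m | m in movable i].
  apply/subsetP => _ /imsetP[j jC ->]; move: (jC); rewrite !in_setD1 => /andP[ji jC'].
  have := twin_old iC jC'; rewrite eq_sym => /(_ ji)/imsetP[m mS e].
  rewrite in_setU1; case: eqVneq => //= d; rewrite e; apply: imset_f.
  rewrite in_set mS -e d; apply/existsP; exists j; by rewrite jC /=.
apply: leq_trans (subset_leq_card h) _; rewrite cardsU1.
by rewrite addnC leq_add ?leq_imset_card ?leq_b1.
Qed.

(** Rotate [u], [i], [j] and swap [m], [l]. The symbol of [(m, m)] survives at [(i, j)], so at most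
    three symbols are lost. In a pair of weight above 2, [d1] to [d4] would make the four gained
    symbols distinct. *)
Lemma twin_pair i j m l : i \in twin -> j \in twin -> i != j ->
  m \notin S -> L m m != L u u -> L m m = L i j ->
  l \in S -> l != i -> l != j ->
  L m l != L u i -> L m l != L u j -> L l m != L u i -> L l m != L u j ->
  W2 m l <= 2.
Proof.
move=> iC jC ij mS dm em lS li lj d1 d2 d3 d4.
have [ui ni ei] := twinE iC; have [uj nj ej] := twinE jC.
have [pu pi pj pD] := cycE ui uj ij.
have ml : m != l by apply: contraNneq mS => ->.
have mu : m != u by apply: contraNneq dm => ->.
have mi : m != i.
  by apply: contraNneq ij => e; rewrite e in em; rewrite (rowI em).
have mj : m != j.
  by apply: contraNneq ij => e; rewrite e in em; rewrite (colI em).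
have ul : u != l by apply: contraNneq uS => ->.
have mk : m != k by apply: contraNneq dm => ->; rewrite euk.
rewrite leqNgt; apply/negP => /(W2_gt2 mS ml)[n1 n2 d].
pose p := (cyc i j * tperm m l)%g.
have qu : p u = i by rewrite permM pu tpermD.
have qi : p i = j by rewrite permM pi tpermD.
have qj : p j = u by rewrite permM pj tpermD // eq_sym.
have qm : p m = l by rewrite permM pD // tpermL.
have ql : p l = m by rewrite permM pD // ?tpermR // eq_sym.
apply: (@exchange_absurd p [:: L i i; L j j; L l l] [:: L u i; L u j; L m l; L l m]) => //.
- move=> x; have [->|xi] := eqVneq x i; first by rewrite inE eqxx; left.
  have [->|xj] := eqVneq x j; first by rewrite !inE eqxx orbT; left.
  have [->|xl] := eqVneq x l; first by rewrite !inE eqxx !orbT; left.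
  have [->|xm] := eqVneq x m; first by right; exists i; rewrite qi.
  have [->|xu] := eqVneq x u.
    move=> _; rewrite euk !inE.
    have [->|ki] := eqVneq k i; first by rewrite eqxx; left.
    have [->|kj] := eqVneq k j; first by rewrite eqxx orbT; left.
    have [->|kl] := eqVneq k l; first by rewrite eqxx !orbT; left.
    right; exists k; rewrite permM pD // 1?eq_sym // tpermD // eq_sym //.
  by rewrite permM pD // tpermD ?eqxx // eq_sym.
- rewrite /= !inE !negb_or (inj_eq (@rowI u)) ij d andbT.
  by rewrite ![L u _ == L _ _]eq_sym d1 d2 d3 d4.
- move=> c; rewrite !inE => /or4P[]/eqP->; split=> //; [exists u|exists j|exists m|exists l].
  + by rewrite qu.
  + by rewrite qj.
  + by rewrite qm.
  + by rewrite ql.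
Qed.

Lemma sum_movable i m : i \in twin -> m \in movable i ->
  \sum_(l in S) W2 m l <= 2 * #|S| + 6.
Proof.
move=> iC; rewrite in_set in_setC => /and3P[mS dm /existsP[j /andP[]]].
rewrite in_setD1 => /andP[ji jC] /eqP em.
pose rowc c := [set l | L m l == c]; pose colc c := [set l | L l m == c].
(* The positions [l] excluded in [twin_pair]: two indices, and at most one for each of two symbols
   in row [m] and in column [m]. *)
pose bad := [set i; j] :|: rowc (L u i) :|: rowc (L u j)
            :|: colc (L u i) :|: colc (L u j).
have rowc1 c : #|rowc c| <= 1.
  by apply/card_le1P => x; rewrite inE => /eqP <- y; rewrite !inE (inj_eq (@rowI m)).
have colc1 c : #|colc c| <= 1.
  by apply/card_le1P => x; rewrite inE => /eqP <- y; rewrite !inE (inj_eq (@colI m)).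
have cardU1 (X Y : {set 'I_n}) a : #|X| <= a -> #|Y| <= 1 -> #|X :|: Y| <= a.+1.
  by move=> hX hY; rewrite (leq_trans (leq_card_setU _ _)) // -addn1 leq_add.
have cbad : #|bad| <= 6.
  apply: (cardU1 _ _ _ _ (colc1 _)); apply: (cardU1 _ _ _ _ (colc1 _)).
  apply: (cardU1 _ _ _ _ (rowc1 _)); apply: (cardU1 _ _ _ _ (rowc1 _)).
  by rewrite cards2; case: (_ != _).
apply: (@leq_trans (\sum_(l in S) (2 + (l \in bad)))).
  apply: leq_sum => l lS; case: (boolP (l \in bad)) => lb.
    by apply: W2_T => //; apply: contraNneq mS => ->.
  move: lb; rewrite !inE !negb_or -!andbA => /and5P[li lj d1 d2 /andP[d3 d4]].
  by apply: twin_pair iC jC _ mS dm em lS li lj d1 d2 d3 d4; rewrite eq_sym.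
rewrite big_split /= sum_nat_const mulnC leq_add2l.
apply: leq_trans cbad; rewrite -sum1_card big_mkcond [leqRHS]big_mkcond /=.
by apply: leq_sum => l _; case: (l \in S); case: (l \in bad).
Qed.

(** * Summation of the weights *)

Lemma sum_T_T : \sum_(t in ~: S) \sum_(j in ~: S) W2 t j <= 2 * (#|~: S| * #|~: S|.-1).
Proof.
rewrite mulnCA -sum_nat_const; apply: leq_sum => t tT.
rewrite (bigD1 t) //= W2_Tdiag -?in_setC // add0n.
rewrite [X in _ <= _ * X.-1](cardsD1 t) tT /= mulnC -sum_nat_const.
rewrite [leqRHS](eq_bigl [pred j | (j \in ~: S) && (j != t)]); last first.
  by move=> j; rewrite in_setD1 andbC.
by apply: leq_sum => j /andP[jT jt]; apply: W2_TT; rewrite -?in_setC // eq_sym.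
Qed.

Local Notation crossing := (\sum_(t in ~: S) \sum_(l in S) W2 t l).

Lemma colors_le_crossing :
  4 * #|[set L c.1 c.2 | c : 'I_n * 'I_n]|
    <= 4 * (#|S| * #|S|) + 2 * crossing + 2 * (#|~: S| * #|~: S|.-1) + 4 * #|O|.
Proof.
have e2 : \sum_i \sum_j W2 i j = 2 * \sum_i \sum_j W i j.
  rewrite mul2n -addnn [X in _ = _ + X]exchange_big -big_split /=.
  by apply: eq_bigr => i _; rewrite -big_split.
have split_S (F : 'I_n -> nat) : \sum_i F i = \sum_(i in S) F i + \sum_(i in ~: S) F i.
  rewrite (bigID [in S]) /=; congr (_ + _).
  by apply: eq_bigl => i; rewrite in_setC.
have eSS : \sum_(i in S) \sum_(j in S) W2 i j <= 4 * (#|S| * #|S|).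
  rewrite mulnCA -sum_nat_const; apply: leq_sum => i _.
  by rewrite mulnC -sum_nat_const; apply: leq_sum => j _; exact: W2_le4.
have eST : \sum_(i in S) \sum_(j in ~: S) W2 i j = crossing.
  by rewrite exchange_big; apply: eq_bigr => i _; apply: eq_bigr => j _; exact: W2C.
have := colors_le_weight; have := sum_T_T; move: e2.
rewrite split_S; under eq_bigr do rewrite split_S.
rewrite big_split /= eST; under [X in _ + X = _]eq_bigr do rewrite split_S.
rewrite big_split /= => e2 hT hW; move: eSS e2 hT hW.
move: (\sum_(i in S) \sum_(j in S) _) (\sum_(i in ~: S) \sum_(j in ~: S) _).
move: crossing (\sum_i \sum_j W i j) (#|S| * #|S|) (#|~: S| * _); lia.
Qed.

(** Against the bound [3 * #|S|] per row, rows [u] and [k] save [#|S|] each and every row of [K]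
    saves [#|S| - 6]. Moving terms across avoids truncated subtraction. *)
Lemma crossing_le (K : {set 'I_n}) : u \notin K -> k \notin K -> K \subset ~: S ->
    (forall m, m \in K -> \sum_(l in S) W2 m l <= 2 * #|S| + 6) ->
  crossing + 2 * #|S| + #|K| * #|S| <= 3 * (#|S| * #|~: S|) + 6 * #|K|.
Proof.
move=> uK kK KT hK;
have count_T (A : {set 'I_n}) c : A \subset ~: S ->
    \sum_(t in ~: S) (if t \in A then c else 0) = #|A| * c.
  move=> AT; rewrite -big_mkcondr -sum_nat_const; apply: eq_bigl => t.
  by apply/andP/idP => [[]//|tA]; split=> //; apply: (subsetP AT).
have uk_T : [set u; k] \subset ~: S by rewrite subUset !sub1set !in_setC uS kS.
have := count_T [set u; k] #|S| uk_T; rewrite cards2 uk /= => <-.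
rewrite -(count_T K #|S| KT) [6 * _]mulnC -(count_T K 6 KT) [#|S| * _]mulnC mulnCA -sum_nat_const.
rewrite -!big_split /=; apply: leq_sum => t; rewrite in_setC => tS.
have triv : \sum_(l in S) W2 t l <= 3 * #|S|.
  rewrite mulnC -sum_nat_const; apply: leq_sum => l lS; apply: W2_T => //.
  by apply: contraNneq tS => ->.
have hdup v w : v != w -> L v v = L w w -> \sum_(l in S) W2 v l <= 2 * #|S|.
  move=> vw e; rewrite mulnC -sum_nat_const; apply: leq_sum => l lS.
  apply: (W2_dup vw e).
  by apply: contraNneq (dup_nonsingle vw e) => ->.
rewrite in_set2; have [tu|tu] /= := eqVneq t u.
  rewrite tu (negPf uK) !addn0; have := hdup u k uk euk.
  by move: (\sum_(l in S) _) #|S|; clear; lia.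
have [tk|tk] /= := eqVneq t k.
  have ku : k != u by rewrite eq_sym.
  rewrite tk (negPf kK) !addn0; have := hdup k u ku (esym euk).
  by move: (\sum_(l in S) _) #|S|; clear; lia.
move: triv; case: ifPn => [/hK|_]; move: (\sum_(l in S) _) #|S|; clear; lia.
Qed.

Lemma few_colors : 4 * #|[set L c.1 c.2 | c : 'I_n * 'I_n]| + 4 <= 3 * (n * n).
Proof.
have hn : n = #|S| + #|~: S| by rewrite cardsC card_ord.
have ht := card_twin; have ht' := card_twin_le.
have hT : 1 < #|~: S| by lia.
(* First without movable rows, to get [#|~: S| + 2 <= #|S|], which makes [twin] nonempty. *)
have h0 : crossing + 2 * #|S| <= 3 * (#|S| * #|~: S|).
  have := @crossing_le set0; rewrite !in_set0 sub0set cards0 !muln0 mul0n !addn0.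
  by apply=> // m; rewrite in_set0.
rewrite leqNgt; apply/negP => lt.
have hs := many_singles_arith hn card_O hT colors_le_crossing h0 lt.
have [e|[i iC]] := set_0Vmem twin; first by rewrite e cards0 in ht; lia.
have h1 : crossing + 2 * #|S| + #|movable i| * #|S|
          <= 3 * (#|S| * #|~: S|) + 6 * #|movable i|.
  (* [u] and [k] are not movable, as they carry the repeated symbol. *)
  apply: crossing_le; rewrite ?in_set ?euk ?eqxx ?andbF //.
    by apply/subsetP => m; rewrite in_set => /andP[].
  by move=> m; apply: sum_movable.
have := few_colors_arith hn card_O hs ht ht' (card_movable iC) colors_le_crossing h1; lia.
Qed.

End MaximalDiagonal.

(** * From the extremal diagonal to arbitrary squares *)

Lemma rainbow_perm (n : nat) (C : finType) (L : 'I_n -> 'I_n -> C) :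
    (forall i, injective (L i)) -> (forall j, injective (L^~ j)) ->
    3 * (n * n) < 4 * #|[set L c.1 c.2 | c : 'I_n * 'I_n]| + 4 ->
  exists p : {perm 'I_n}, injective (fun i => L i (p i)).
Proof.
move=> rowI colI many.
(* Since [#|singles L p| <= n], the factor [n.+1] makes this a lexicographic maximum. *)
pose Phi p := #|colors L p| * n.+1 + #|singles L p|.
have [p0 max_p0] : exists p0 : {perm 'I_n}, forall p, Phi p <= Phi p0.
  by case: (@arg_maxnP _ 1%g xpredT Phi isT) => p _ h; exists p => q; exact: h.
have singles_le p : #|singles L p| <= n by rewrite -[leqRHS]card_ord max_card.
exists p0; apply/injectiveP; apply: contraLR many => /injectivePn[u [k uk euk]].
rewrite -leqNgt; pose L' i j := L i (p0 j).
have colorsE p : colors L' p = colors L (p * p0)%g.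
  by apply: eq_imset => i; rewrite permM.
have singleE i j : single L' i j = single L i (p0 j).
  apply/forallP/forallP => h x; apply/forallP => y.
    have /forallP/(_ (p0^-1%g y)) := h x.
    by rewrite /L' permKV -[_ == j](inj_eq (@perm_inj _ p0)) permKV.
  by have /forallP/(_ (p0 y)) := h x; rewrite (inj_eq perm_inj).
have singlesE p : singles L' p = singles L (p * p0)%g.
  by apply/setP => i; rewrite !in_set singleE permM.
have S'E : [set i | single L' i i] = singles L p0.
  by apply/setP => i; rewrite !in_set singleE.
have symbE : [set L' c.1 c.2 | c : 'I_n * 'I_n] = [set L c.1 c.2 | c : 'I_n * 'I_n].
  apply/setP => c; apply/imsetP/imsetP => -[[x y] _ ->].
    by exists (x, p0 y).
  by exists (x, p0^-1%g y); rewrite // /L' /= permKV.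
have := @few_colors n C L' _ _ _ _ u k uk euk; rewrite symbE; apply.
- by move=> i x y /rowI/perm_inj.
- by move=> j x y /colI.
- move=> p; rewrite colorsE -/(colors L p0); have := max_p0 (p * p0)%g; rewrite /Phi => h.
  rewrite leqNgt; apply/negP => lt; have := leq_mul lt (leqnn n.+1).
  have := singles_le p0; move: h; rewrite mulSn; lia.
- move=> p; rewrite colorsE S'E singlesE => e.
  by have := max_p0 (p * p0)%g; rewrite /Phi e leq_add2l.
Qed.

Lemma perm_transversal (n : nat) (T : eqType) (L : 'M[T]_n) (p : {perm 'I_n}) :
  injective (fun i => L i (p i)) -> Defs.transversal L [set (i, p i) | i : 'I_n].
Proof.
move=> inj; set D := [set _ | _ in _].
have DE x : (x \in D) = (x.2 == p x.1).
  by apply/imsetP/eqP => [[i _ ->]//|e]; exists x.1; rewrite // -e; case: x {e}.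
split; first split.
- by rewrite card_imset ?card_ord // => i j [].
- move=> i; apply/eqP/cards1P; exists (i, p i); apply/setP => -[x y].
  by rewrite !inE DE /= xpair_eqE andbC; case: eqP => //= ->.
- move=> j; apply/eqP/cards1P; exists (p^-1%g j, j); apply/setP => -[x y].
  rewrite !inE DE /= xpair_eqE [RHS]andbC; case: (y =P j) => [->|]; rewrite ?andbF ?andbT //.
  by apply/eqP/eqP => ->; rewrite ?permK ?permKV.
- move=> [x y] [x' y']; rewrite !DE /= => /eqP-> /eqP-> e.
  by rewrite (inj _ _ e).
Qed.

(** Rounding down costs less than one symbol: [3 * n^2 < 4 * q + 4] holds for every [q] at least the
    quotient, which is the form [rainbow_perm] takes. *)
Lemma forces_transversal_bound (n : nat) : forces_transversal n (3 * (n * n) %/ 4).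
Proof.
move=> T L [rowI colI] many.
(* Each symbol is replaced by a chosen position carrying it, so that the colors form a finite
   type. *)
pose rep (c : 'I_n * 'I_n) := odflt c [pick d | L d.1 d.2 == L c.1 c.2].
have repK c : L (rep c).1 (rep c).2 = L c.1 c.2.
  by rewrite /rep; case: pickP => [d /eqP|/(_ c)]; rewrite ?eqxx.
have rep_eq c d : rep c = rep d -> L c.1 c.2 = L d.1 d.2.
  by move=> e; rewrite -repK e repK.
have eq_rep c d : L c.1 c.2 = L d.1 d.2 -> rep c = rep d.
  move=> e; rewrite /rep (eq_pick (Q := fun x => L x.1 x.2 == L d.1 d.2)); last first.
    by move=> x /=; rewrite e.
  by case: pickP => // /(_ d); rewrite eqxx.
have many_reps : num_symbols L <= #|[set rep (c.1, c.2) | c : 'I_n * 'I_n]|.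
  rewrite /num_symbols cardE.
  rewrite -(size_map (fun c => L c.1 c.2)); apply: uniq_leq_size (undup_uniq _) _.
  move=> t; rewrite mem_undup => /mapP[c _ ->]; rewrite -repK.
  by apply: map_f; rewrite mem_enum; apply/imsetP; exists c => //; case: c.
have [|||p inj] := @rainbow_perm n _ (fun i j => rep (i, j)).
- by move=> i x y /rep_eq/rowI.
- by move=> j x y /rep_eq/colI.
- have := leq_trans many many_reps; lia.
exists [set (i, p i) | i : 'I_n]; apply: perm_transversal => i j e.
by apply: inj; apply: eq_rep.
Qed.

Local Open Scope ring_scope.

Theorem theorem1 (n : nat) (hn : (1 < n)%N) :
  (l n)%:R <= 3%:R / 4%:R * n%:R ^+ 2 :> rat.
Proof.
have h : (4 * l n <= 3 * (n * n))%N.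
  rewrite /l; case: ex_minnP => m _ /(_ (3 * (n * n) %/ 4)%N) min.
  have := min (introT (boolp.asboolP _) (forces_transversal_bound n)); lia.
rewrite mulrAC ler_pdivlMr ?ltr0n // mulrC expr2 -!natrM ler_nat; exact: h.
Qed.
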